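(* Let $G$ be a weighted unicyclic graph and let $C$ be the cycle of $G$ (with the weights inherited from $G$). (i) If $G$ is of Type I and $v\in C$ is matched in $G\{v\}$, then $$i_+(G)=i_+(G\{v\})+i_+(G-G\{v\}),\qquad i_-(G)=i_-(G\{v\})+i_-(G-G\{v\}).$$ (ii) If $G$ is of Type II, then $$i_+(G)=i_+(G-C)+i_+(C),\qquad i_-(G)=i_-(G-C)+i_-(C).$$
   Context: A weighted graph is a finite simple graph $G$ together with a weight function assigning a positive real number $w(e)>0$ to each edge $e$. If $V_G=\{v_1,\dots,v_n\}$, its weighted adjacency matrix $A(G)=(a_{ij})$ is the real symmetric $n\times n$ matrix with $a_{ij}=w(v_iv_j)$ if $v_iv_j$ is an edge and $a_{ij}=0$ otherwise. $i_+(G)$ and $i_-(G)$ denote the numbers of positive and negative eigenvalues of $A(G)$, counted with multiplicity (both are $0$ for the empty graph). Subgraphs carry the inherited weights. For an induced subgraph $H$ of $G$, $G-H$ is obtained from $G$ by deleting all vertices of $H$ and all edges incident with them. A unicyclic graph is a simple connected graph whose number of edges equals its number of vertices; it has a unique cycle. A vertex $v$ of a tree $T$ with at least two vertices is called mismatched in $T$ if some maximum matching of $T$ does not cover $v$, and matched in $T$ otherwise; the vertex of a one-vertex tree is considered mismatched. For a weighted unicyclic graph $G$ with cycle $C$ and a vertex $v\in C$, $G\{v\}$ denotes the induced connected weighted subgraph of $G$ with the maximum possible number of vertices which contains $v$ and no other vertex of $C$ (it is a tree). $G$ is of Type I if there is a vertex $v$ on $C$ such that $v$ is matched in $G\{v\}$;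 otherwise $G$ is of Type II. *)

(* Defs.v *)
From HB Require Import structures.
From mathcomp Require Import all_boot all_order all_algebra.
From mathcomp Require Import polyrcf.
From mathcomp Require Import reals.

Set Implicit Arguments.
Unset Strict Implicit.
Unset Printing Implicit Defensive.

Import Order.TTheory GRing.Theory Num.Theory.

Local Open Scope ring_scope.

(* Only the values of [weight] on pairs joined by an edge are meaningful. *)
Record wgraph (R : rcfType) := WGraph {
  vertex :> finType;
  edge : rel vertex;
  weight : vertex -> vertex -> R;
  edge_sym : symmetric edge;
  edge_irr : irreflexive edge;
  weight_sym : forall x y, edge x y -> weight x y = weight y x;
  weight_gt0 : forall x y, edge x y -> 0 < weight x y
}.

Section Defs.

Variable R : rcfType.
Implicit Type G : wgraph R.

Definition adjacency G : 'M[R]_#|G| :=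
  \matrix_(i, j) (if edge (enum_val i) (enum_val j)
                  then weight (enum_val i) (enum_val j) else 0).

(* [rootsR p] lists the distinct roots of [p] in [R], and [mup x p] is the
   multiplicity of [x] as a root of [p]. *)
Definition i_pos G : nat :=
  let p := char_poly (adjacency G) in
  (\sum_(x <- rootsR p | (0 < x)%R) mup x p)%N.

Definition i_neg G : nat :=
  let p := char_poly (adjacency G) in
  (\sum_(x <- rootsR p | (x < 0)%R) mup x p)%N.

Definition edges G : {set {set G}} :=
  [set [set x; y] | x in G, y in G & edge x y].

Definition connected G : bool :=
  (0 < #|G|)%N && [forall x : G, forall y : G, connect (@edge R G) x y].

Definition unicyclic G : bool := connected G && (#|edges G| == #|G|).

Section Subgraph.

Variables (G : wgraph R) (S : {set G}) (E : {set {set G}}).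

Let sub_edge : rel {x : G | x \in S} :=
  fun x y => edge (val x) (val y) && ([set val x; val y] \in E).

Let sub_weight (x y : {x : G | x \in S}) : R := weight (val x) (val y).

Fact sub_edge_sym : symmetric sub_edge.
Proof. by move=> x y; rewrite /sub_edge edge_sym setUC. Qed.

Fact sub_edge_irr : irreflexive sub_edge.
Proof. by move=> x; rewrite /sub_edge edge_irr. Qed.

Fact sub_weight_sym x y : sub_edge x y -> sub_weight x y = sub_weight y x.
Proof. by case/andP=> + _; apply: weight_sym. Qed.

Fact sub_weight_gt0 x y : sub_edge x y -> 0 < sub_weight x y.
Proof. by case/andP=> + _; apply: weight_gt0. Qed.

(* Vertex set [S], and those edges of [G] between vertices of [S] that lie
   in [E]. *)
Definition subgraph : wgraph R :=
  WGraph sub_edge_sym sub_edge_irr sub_weight_sym sub_weight_gt0.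

End Subgraph.

Definition induced G (S : {set G}) : wgraph R := subgraph S setT.

Definition delete G (S : {set G}) : wgraph R := induced (~: S).

Definition matching G (M : {set {set G}}) : bool :=
  (M \subset edges G) && trivIset M.

Definition maximum_matching G (M : {set {set G}}) : bool :=
  matching M && [forall N : {set {set G}}, matching N ==> (#|N| <= #|M|)%N].

Definition mismatched G (v : G) : bool :=
  (#|G| == 1%N) ||
  [exists M : {set {set G}}, maximum_matching M && (v \notin cover M)].

Definition matched G (v : G) : bool := ~~ mismatched v.

(* A cycle is given by the sequence of its vertices in cyclic order. *)
Definition is_cycle G (c : seq G) : bool :=
  [&& (2 < size c)%N, uniq c & cycle (@edge R G) c].

Definition cycle_graph G (c : seq G) : wgraph R :=
  subgraph [set x in c] [set [set x; next c x] | x in c].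

Definition branch_set_cond G (c : seq G) (v : G) (S : {set G}) : bool :=
  [&& v \in S, [forall x in c, (x \in S) ==> (x == v)]
    & connected (induced S)].

(* The vertex set of G{v}. The default [set v] satisfies the condition, see
   [branch_set_cond1], so this is a genuine maximizer. *)
Definition branch_set G (c : seq G) (v : G) : {set G} :=
  [arg max_(S > [set v] | branch_set_cond c v S) #|S|]%N.

Definition branch G (c : seq G) (v : G) : wgraph R := induced (branch_set c v).

Lemma branch_set_cond1 G (c : seq G) (v : G) : branch_set_cond c v [set v].
Proof.
have vP : v \in [set v] by rewrite set11.
rewrite /branch_set_cond vP /=; apply/andP; split.
  by apply/forall_inP=> x _; apply/implyP; rewrite inE.
apply/andP; split; first by apply/card_gt0P; exists (exist _ v vP).
apply/forallP=> x; apply/forallP=> y; suff -> : x = y by apply: connect0.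
by apply: val_inj; move: (valP x) (valP y); rewrite !inE => /eqP-> /eqP->.
Qed.

Lemma mem_branch_set G (c : seq G) (v : G) : v \in branch_set c v.
Proof.
rewrite /branch_set; case: arg_maxnP; first exact: branch_set_cond1.
by move=> S /and3P[].
Qed.

(* The vertex v, as a vertex of G{v}. *)
Definition branch_root G (c : seq G) (v : G) : branch c v :=
  exist _ v (mem_branch_set c v).

Definition typeI G (c : seq G) : bool :=
  [exists v in c, matched (branch_root c v)].

Definition typeII G (c : seq G) : bool := ~~ typeI c.

End Defs.

(* Main.v *)
Require Import Defs.
From HB Require Import structures.
From mathcomp Require Import all_boot all_order all_algebra.
From mathcomp Require Import fingroup perm.
From mathcomp Require Import polyrcf complex sesquilinear spectral.
From mathcomp Require Import reals.

(**
The adjacency matrix A is the Gram matrix of a symmetric bilinear form on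
functions on the vertices, and by Sylvester's law of inertia the numbers of
positive and negative eigenvalues are invariants of that form
([sign_count_congr]). So it is enough to find a basis in which the form is a
direct sum of the two forms on the right-hand side. If the vertices are split
into S and its complement, and each basis vector outside S is corrected by a
vector supported in S so as to become orthogonal to S, the inertia of A is that
of its restriction to S plus that of the corrected form on the complement
([sign_count_split]).

The correcting vectors come from trees. In a forest with adjacency matrix A a
vertex v satisfies exactly one of the following ([forest_vector]):
- some maximum matching misses v, and there is y with y_v = 1 and A y = 0;
- every maximum matching covers v, and there is z with z_v = 0 and A z = e_v.
This is proved by removing a leaf u different from v together with its
neighbour p: the matching number drops by one whether or not v is present, so
the alternative for v is unchanged, and a vector for the smaller forest extends
by a suitable value at u and 0 at p. If v itself is p, then z is a multiple
of e_u. If v is isolated, then y is e_v.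

The graph enters only through the following fact ([unicyclic_bridge]): once
some edge e of the cycle is deleted, each other edge is a bridge. Indeed G
minus e is still connected, and if it remained connected after deleting one
more edge, it would be connected with fewer than |V| - 1 edges. Hence the cycle
has no chord, each G{v} is acyclic, and only v has neighbours outside G{v}
([branch_edge_root]).

In Type I take S to be the vertex set of G{v}, and correct each outer
neighbour j of v by -A(j,v) z. In Type II take S to be the complement of C, and
replace e_v, for each v on C, by the kernel vector y of G{v}. These vectors are
orthogonal to all vertices outside C, and their mutual products are the entries
of the adjacency matrix of C.
*)

Set Implicit Arguments.
Unset Strict Implicit.
Unset Printing Implicit Defensive.

Import Order.TTheory GRing.Theory Num.Theory.

Local Open Scope ring_scope.
Local Open Scope sesquilinear_scope.

(** * Counting the roots of a split polynomial *)

Section RootCount.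
Variable R : rcfType.

(** The number of roots of [p] that satisfy [P], counted with multiplicity. *)
Definition root_count (P : pred R) (p : {poly R}) : nat :=
  (\sum_(x <- rootsR p | P x) mup x p)%N.

Lemma mup_prodXsubC (s : seq R) (x : R) :
  mup x (\prod_(y <- s) ('X - y%:P)) = count_mem x s.
Proof.
elim: s => [|y s IHs]; first by rewrite big_nil mupNroot //= root1.
rewrite big_cons mupM ?polyXsubC_eq0 ?monic_neq0 ?monic_prod_XsubC // IHs /=.
by rewrite -['X - y%:P]expr1 mup_XsubCX.
Qed.

Lemma root_count_prodXsubC (P : pred R) (s : seq R) :
  root_count P (\prod_(x <- s) ('X - x%:P)) = count P s.
Proof.
set p := \prod_(x <- s) _.
have p_neq0 : p != 0 by rewrite monic_neq0 ?monic_prod_XsubC.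
have mem_roots : rootsR p =i s.
  move=> x; have /(_ x) := roots_on_rootsR p_neq0.
  by rewrite in_itv /= root_prod_XsubC => ->.
rewrite /root_count (eq_bigr (fun x => count_mem x s)); last first.
  by move=> x _; rewrite mup_prodXsubC.
rewrite (perm_big (undup s)); last first.
  apply: uniq_perm; rewrite ?undup_uniq ?uniq_roots // => x.
  by rewrite mem_roots mem_undup.
rewrite -sum1_count -[RHS]big_undup_iterop_count /=.
by apply: eq_bigr => x _; rewrite Monoid.iteropE iter_addn_0 mul1n.
Qed.

End RootCount.

(** * Characteristic polynomials *)

Lemma char_poly_conj (R : comNzRingType) n (P Q A : 'M[R]_n) :
  P *m Q = 1%:M -> char_poly (P *m A *m Q) = char_poly A.
Proof.
move=> PQ1; rewrite /char_poly.
have -> : char_poly_mx (P *m A *m Q)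
    = map_mx polyC P *m char_poly_mx A *m map_mx polyC Q.
  rewrite /char_poly_mx mulmxBr mulmxBl !map_mxM; congr (_ - _).
  by rewrite scalar_mxC -mulmxA -map_mxM PQ1 map_mx1 mulmx1.
by rewrite !det_mulmx mulrAC -det_mulmx -map_mxM PQ1 map_mx1 det1 mul1r.
Qed.

Lemma char_poly_reindex (R : comNzRingType) m n (g : 'I_m -> 'I_n) (A : 'M[R]_n) :
  bijective g -> char_poly (mxsub g g A) = char_poly A.
Proof.
move=> bij_g; have eq_mn : m = n by have := bij_eq_card bij_g; rewrite !card_ord.
subst m; pose s := perm (bij_inj bij_g).
rewrite -[RHS](@char_poly_conj _ _ (perm_mx s) (perm_mx s^-1)); last first.
  by rewrite -perm_mxM mulgV perm_mx1.
rewrite -row_permE -col_permE; congr char_poly.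
by apply/matrixP => i j; rewrite !mxE !permE.
Qed.

Lemma char_poly_block_diag (R : comNzRingType) m n (A : 'M[R]_m) (B : 'M[R]_n) :
  char_poly (block_mx A 0 0 B) = char_poly A * char_poly B.
Proof. by rewrite /char_poly char_block_diag_mx det_ublock. Qed.

(** * Sylvester's law of inertia *)

Section Sylvester.
Variable R : rcfType.
Local Notation C := R[i].
Local Notation toC := (map_mx (real_complex R)).

(** The spectral theorem for a real symmetric matrix, with a unitary change of
    basis over [R[i]] and real eigenvalues [d]. *)
Lemma spectral_realsym n (A : 'M[R]_n) : A^T = A ->
  exists U : 'M[C]_n, exists d : 'rV[R]_n, [/\ U \is unitarymx,
    toC A = U^t* *m diag_mx (toC d) *m U &
    char_poly A = \prod_(i < n) ('X - (d 0 i)%:P)].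
Proof.
move=> symA; have realA : toC A \is a realmx.
  by apply/mxOverP => i j; rewrite mxE complex_real.
have hermA : toC A \is hermsymmx.
  apply: realsym_hermsym realA.
  by apply/is_hermitianmxP; rewrite expr0 scale1r map_mx_id // map_trmx symA.
have /orthomx_spectralP eqA := hermitian_normalmx hermA.
have realD := hermitian_spectral_diag_real hermA.
set U := spectralmx _ in eqA; set D := spectral_diag _ in eqA realD.
have unitU : U \is unitarymx := spectral_unitarymx _.
exists U, (map_mx (@complex.Re R) D).
have eqD : toC (map_mx (@complex.Re R) D) = D.
  by apply/matrixP => i j; rewrite !mxE RRe_real // (mxOverP realD).
split => //; first by rewrite eqD -invmx_unitary.
apply: (map_poly_inj (real_complex R)); rewrite map_char_poly eqA.
rewrite char_poly_conj ?mulVmx ?unitarymx_unit //.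
rewrite char_poly_trig ?diag_mx_is_trig // rmorph_prod; apply: eq_bigr => i _.
by rewrite rmorphB /= map_polyX map_polyC /= -[in LHS]eqD !mxE eqxx.
Qed.

Lemma diag_formE n (d : 'rV[R]_n) (w : 'rV[C]_n) :
  (w *m diag_mx (toC d) *m w^t*) 0 0 = \sum_j (d 0 j)%:C%C * `|w 0 j| ^+ 2.
Proof.
rewrite mul_mx_diag mxE; apply: eq_bigr => j _.
by rewrite !mxE mulrAC normCK mulrC.
Qed.

(** The inertia inequality for diagonal forms. If it failed, then a nonzero
    vector [w] supported where [e * d'] is positive would have an image [w *m P]
    vanishing wherever [e * d] is positive; [e] times the form would be positive
    at [w] by [d'] and nonpositive by [d]. The factor [e] covers both signs. *)
Lemma diag_congr_card_le n (d d' : 'rV[R]_n) (P : 'M[C]_n) (e : R) :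
  diag_mx (toC d') = P *m diag_mx (toC d) *m P^t* ->
  (#|[pred i | (0 < e * d' 0 i)%R]| <= #|[pred i | (0 < e * d 0 i)%R]|)%N.
Proof.
set S' := [pred i | _]; set S := [pred i | _] => eqd'.
rewrite leqNgt; apply/negP => ltSS'.
pose Q := \matrix_(i < #|S'|, j < #|S|) P (enum_val i) (enum_val j).
(* [Q] has more rows than columns, hence a nonzero left kernel. *)
have /rowV0Pn[u /sub_kermxP uQ0 u_neq0] : kermx Q != 0.
  rewrite kermx_eq0 /row_free neq_ltn.
  by rewrite (leq_ltn_trans (rank_leq_col Q) ltSS').
pose E := \matrix_(i < #|S'|, j < n) (enum_val i == j)%:R : 'M[C]_(#|S'|, n).
pose w := u *m E.
have wE k : w 0 (enum_val k) = u 0 k.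
  rewrite mxE (bigD1 k) //= big1 => [|i neq_ik].
    by rewrite mxE eqxx mulr1 addr0.
  by rewrite mxE (inj_eq enum_val_inj) (negPf neq_ik) mulr0.
have w0 j : j \notin S' -> w 0 j = 0.
  move=> jS'; rewrite mxE big1 // => i _; rewrite mxE; case: eqP => [eqj|_].
    by rewrite -eqj enum_valP in jS'.
  by rewrite mulr0.
have wP0 j : j \in S -> (w *m P) 0 j = 0.
  move=> jS; have /rowP/(_ (enum_rank_in jS j)) := uQ0.
  rewrite [in LHS]mxE [RHS]mxE => <-.
  rewrite mxE (bigID (mem S')) /= addrC big1 ?add0r; last first.
    by move=> i iS'; rewrite w0 // mul0r.
  rewrite (big_enum_val (fun i => w 0 i * P i j)).
  by apply: eq_bigr => i _; rewrite wE mxE enum_rankK_in.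
have eq_form : \sum_j (d' 0 j)%:C%C * `|w 0 j| ^+ 2
             = \sum_j (d 0 j)%:C%C * `|(w *m P) 0 j| ^+ 2.
  rewrite -!diag_formE eqd' [(w *m P)^T]trmx_mul map_mxM /=.
  by rewrite !mulmxA.
have /(congr1 ( *%R e%:C%C)) := eq_form; rewrite !mulr_sumr.
have [k uk_neq0] : exists k, u 0 k != 0.
  apply/existsP; apply: contraR u_neq0; rewrite negb_exists => /forallP u0.
  by apply/eqP/rowP => k; rewrite mxE; apply/eqP; have := u0 k; rewrite negbK.
have lhs_gt0 : 0 < \sum_j e%:C%C * ((d' 0 j)%:C%C * `|w 0 j| ^+ 2).
  rewrite (bigD1 (enum_val k)) //= ltr_pwDl //.
    rewrite mulrA -rmorphM mulr_gt0 ?ltcR ?exprn_gt0 ?normr_gt0 ?wE //.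
    exact: (enum_valP k).
  apply: sumr_ge0 => j _; have [jS'|jS'] := boolP (j \in S'); last first.
    by rewrite w0 // normr0 expr0n !mulr0.
  by rewrite mulrA -rmorphM mulr_ge0 ?exprn_ge0 // lecR ltW.
have rhs_le0 : \sum_j e%:C%C * ((d 0 j)%:C%C * `|(w *m P) 0 j| ^+ 2) <= 0.
  apply: sumr_le0 => j _; have [jS|] := boolP (j \in S).
    by rewrite wP0 // normr0 expr0n !mulr0.
  rewrite inE -leNgt => le0; rewrite mulrA -rmorphM.
  by rewrite mulr_le0_ge0 ?exprn_ge0 // lecR.
by move=> eqs; move: lhs_gt0; rewrite eqs (le_gtF rhs_le0).
Qed.

(** The number of eigenvalues [x] of [A] with [0 < e * x], counted with
    multiplicity: the positive ones for [e = 1], the negative ones for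
    [e = -1]. *)
Definition sign_count n (e : R) (A : 'M[R]_n) : nat :=
  root_count (fun x => 0 < e * x) (char_poly A).

Lemma sign_count_spectral n (e : R) (A : 'M[R]_n) (d : 'rV[R]_n) :
  char_poly A = \prod_(i < n) ('X - (d 0 i)%:P) ->
  sign_count e A = #|[pred i | 0 < e * d 0 i]|.
Proof.
move=> eqA; rewrite /sign_count eqA.
rewrite -(big_map (fun i => d 0 i) xpredT (fun x => 'X - x%:P)).
rewrite root_count_prodXsubC count_map -sum1_card -sum1_count.
by rewrite -big_enum /= big_filter_cond.
Qed.

Lemma sign_count_congr_le n (e : R) (A L : 'M[R]_n) : A^T = A ->
  (sign_count e (L *m A *m L^T) <= sign_count e A)%N.
Proof.
move=> symA; have symB : (L *m A *m L^T)^T = L *m A *m L^T.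
  by rewrite !trmx_mul trmxK symA mulmxA.
have [U [d [unitU eqA /sign_count_spectral-> ]]] := spectral_realsym symA.
have [V [d' [unitV eqB /sign_count_spectral-> ]]] := spectral_realsym symB.
apply: (@diag_congr_card_le _ _ _ (V *m toC L *m U^t*)).
have LtC : (toC L)^t* = toC L^T.
  by apply/matrixP => i j; rewrite !mxE; apply: conj_Creal; rewrite complex_real.
rewrite !trmx_mul !map_mxM /= trmxCK LtC.
move: eqB; rewrite !map_mxM /= eqA => /(congr1 (fun X => V *m X *m V^t*)).
rewrite !mulmxA (unitarymxP unitV) mul1mx mulmxtVK // => <-.
Qed.

Lemma sign_count_congr n (e : R) (A L : 'M[R]_n) : A^T = A -> L \in unitmx ->
  sign_count e (L *m A *m L^T) = sign_count e A.
Proof.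
move=> symA unitL; apply/eqP; rewrite eqn_leq sign_count_congr_le //=.
have {1}-> : A = invmx L *m (L *m A *m L^T) *m (invmx L)^T.
  rewrite !mulmxA mulVmx // mul1mx -mulmxA -trmx_mul.
  by rewrite mulVmx // trmx1 mulmx1.
by apply: sign_count_congr_le; rewrite !trmx_mul trmxK symA mulmxA.
Qed.

Lemma sign_count_block_diag m n (e : R) (A : 'M[R]_m) (B : 'M[R]_n) :
  A^T = A -> B^T = B ->
  sign_count e (block_mx A 0 0 B) = (sign_count e A + sign_count e B)%N.
Proof.
move=> /spectral_realsym[_ [d [_ _ eqA]]] /spectral_realsym[_ [d' [_ _ eqB]]].
rewrite /sign_count char_poly_block_diag eqA eqB.
rewrite -(big_map (fun i => d 0 i) xpredT (fun x => 'X - x%:P)).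
rewrite -(big_map (fun i => d' 0 i) xpredT (fun x => 'X - x%:P)).
by rewrite -big_cat !root_count_prodXsubC count_cat.
Qed.

(** Block elimination: the congruence by the matrix with blocks [1], [0], [N],
    [1] makes the matrix block diagonal. *)
Lemma sign_count_schur m n (e : R) (A : 'M[R]_m) (B : 'M[R]_(m, n))
    (D D' : 'M[R]_n) (N : 'M[R]_(n, m)) :
  A^T = A -> D^T = D -> D'^T = D' -> N *m A + B^T = 0 -> D + N *m B = D' ->
  sign_count e (block_mx A B B^T D) = (sign_count e A + sign_count e D')%N.
Proof.
move=> symA symD symD' NA ND; rewrite -sign_count_block_diag //.
pose L : 'M[R]_(m + n) := block_mx 1%:M 0 N 1%:M.
have unitL : L \in unitmx by rewrite unitmxE det_lblock !det1 mulr1 unitr1.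
rewrite -(@sign_count_congr _ _ _ L) //; last first.
  by rewrite tr_block_mx trmxK symA symD.
congr sign_count; rewrite tr_block_mx !trmx1 trmx0 !mulmx_block.
rewrite !(mul1mx, mul0mx, mulmx0, mulmx1, addr0, add0r).
rewrite NA mul0mx add0r [N *m B + D]addrC ND; congr (block_mx _ _ _ _).
by rewrite -[B]trmxK -{1}symA -trmx_mul -linearD NA linear0.
Qed.

End Sylvester.

(** * Splitting the inertia of a graph along a vertex set *)

Section Adj.
Variables (R : rcfType) (G : wgraph R).

(** The adjacency matrix of [G], indexed by the vertices themselves. *)
Definition adj (x y : G) : R := if edge x y then weight x y else 0.

Lemma adj_sym x y : adj x y = adj y x.
Proof. by rewrite /adj (edge_sym y x); case: ifP => // /weight_sym. Qed.

Lemma adjxx x : adj x x = 0.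
Proof. by rewrite /adj edge_irr. Qed.

Lemma adjacency_sym : (adjacency G)^T = adjacency G.
Proof. by apply/matrixP => i j; rewrite !mxE [LHS]adj_sym. Qed.

End Adj.

(** Replace, for each [j] outside [S], the basis vector of [j] by its sum with
    the vector [N j] restricted to [S]. If the new vectors are orthogonal to [S]
    and their mutual products are the entries of the adjacency matrix of the
    subgraph on the complement of [S] with edges in [E], then the inertia is
    additive. *)
Lemma sign_count_split (R : rcfType) (G : wgraph R) (e : R) (S S' : {set G})
    (E : {set {set G}}) (N : G -> G -> R) :
  S' = ~: S ->
  (forall j t, j \notin S -> t \in S ->
     adj j t + \sum_(s in S) N j s * adj s t = 0) ->
  (forall j k, j \notin S -> k \notin S ->
     adj j k + \sum_(s in S) N j s * adj s k
     = if [set j; k] \in E then adj j k else 0) ->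
  sign_count e (adjacency G)
  = (sign_count e (adjacency (induced S))
     + sign_count e (adjacency (subgraph S' E)))%N.
Proof.
move=> -> N_S N_SC; set H1 := induced S; set H2 := subgraph _ _.
pose h1 (i : 'I_#|H1|) : G := sval (enum_val i : {x | x \in S}).
pose h2 (i : 'I_#|H2|) : G := sval (enum_val i : {x | x \in ~: S}).
have h1S i : h1 i \in S by exact: (svalP (enum_val i : {x | x \in S})).
have h2S i : h2 i \notin S.
  by have := svalP (enum_val i : {x | x \in ~: S}); rewrite inE.
(* The vertices, listed with those of [S] before the others. *)
pose g (i : 'I_(#|H1| + #|H2|)) : 'I_#|G| :=
  enum_rank (match split i with inl j => h1 j | inr k => h2 k end).
have bij_g : bijective g.
  apply: inj_card_bij; last first.
    by rewrite !card_ord !card_sig cardsC.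
  move=> i j /enum_rank_inj.
  case: (splitP i) => i1 eq_i; case: (splitP j) => j1 eq_j.
  - by move=> /val_inj/enum_val_inj eq1; apply: val_inj; rewrite /= eq_i eq_j eq1.
  - by move=> eqh; have := h2S j1; rewrite -eqh h1S.
  - by move=> eqh; have := h2S i1; rewrite eqh h1S.
  - by move=> /val_inj/enum_val_inj eq1; apply: val_inj; rewrite /= eq_i eq_j eq1.
rewrite {1}/sign_count -(char_poly_reindex _ bij_g) -/(sign_count _ _).
pose A := adjacency H1.
pose B := \matrix_(i, j) adj (h1 i) (h2 j).
pose D := \matrix_(i, j) adj (h2 i) (h2 j).
have -> : mxsub g g (adjacency G) = block_mx A B B^T D.
  apply/matrixP => i j; rewrite !mxE !enum_rankK -/(adj _ _).
  case: (splitP i) => i1 _; rewrite !mxE; case: (splitP j) => j1 _; rewrite !mxE //.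
    by rewrite /= in_setT andbT.
  by rewrite adj_sym.
have sumS (F : G -> R) : \sum_(i < #|H1|) F (h1 i) = \sum_(s in S) F s.
  rewrite [RHS]big_sub.
  exact: esym (big_enum_val (fun x : H1 => F (sval (x : {x | x \in S})))).
apply: (@sign_count_schur _ _ _ _ _ _ _ _ (\matrix_(i, j) N (h2 i) (h1 j))).
- exact: adjacency_sym.
- by apply/matrixP => i j; rewrite !mxE adj_sym.
- exact: adjacency_sym.
- apply/matrixP => i j; rewrite !mxE addrC adj_sym -[RHS](N_S (h2 i) (h1 j)) //.
  congr (_ + _); rewrite -sumS; apply: eq_bigr => k _; rewrite !mxE /=.
  by rewrite in_setT andbT.
- apply/matrixP => i j; rewrite !mxE /=.
  rewrite -[RHS]/(if edge (h2 i) (h2 j) && ([set h2 i; h2 j] \in E)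
    then weight (h2 i) (h2 j) else 0).
  have -> : \sum_(k < #|H1|) (\matrix_(i0, j1) N (h2 i0) (h1 j1)) i k * B k j
      = \sum_(s in S) N (h2 i) s * adj s (h2 j).
    by rewrite -sumS; apply: eq_bigr => k _; rewrite !mxE.
  rewrite N_SC // /adj; case: ifP => [_|_]; first by rewrite andbT.
  by rewrite andbF.
Qed.

(** * Matching numbers *)

Section Matching.
Variables (R : rcfType) (G : wgraph R).
Implicit Types (S : {set G}) (M : {set {set G}}) (u v p q x y : G).

Lemma mem_edges x y : ([set x; y] \in edges G) = edge x y.
Proof.
apply/imset2P/idP => [[a b _ /[!inE]/= ab eqs]|xy]; last first.
  by exists x y; rewrite ?inE.
have : x \in [set a; b] by rewrite -eqs set21.
have : y \in [set a; b] by rewrite -eqs set22.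
have : a \in [set x; y] by rewrite eqs set21.
have : b \in [set x; y] by rewrite eqs set22.
rewrite !inE.
case/pred2P => eqb; case/pred2P => eqa; subst a b; rewrite ?orbb.
- by rewrite edge_irr in ab.
- by rewrite edge_sym.
- by [].
- by rewrite edge_irr in ab.
Qed.

Lemma edges_at (A : {set G}) u : A \in edges G -> u \in A ->
  exists2 q, edge u q & A = [set u; q].
Proof.
case/imset2P => x y _ /[!inE]/= xy -> /set2P[->|->]; first by exists y.
by exists x; rewrite 1?edge_sym // setUC.
Qed.

(** [M] is a matching whose edges have both ends in [S]. *)
Definition matching_in S M := matching M && (cover M \subset S).

(** The matching number of the subgraph induced by [S]. *)
Definition matching_number S : nat := \max_(M | matching_in S M) #|M|.

Local Notation mu := matching_number.

Lemma matching_in0 S : matching_in S set0.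
Proof.
rewrite /matching_in /matching sub0set /cover big_set0 sub0set andbT.
by apply/trivIsetP => A B; rewrite inE.
Qed.

Lemma leq_matching_number S M : matching_in S M -> (#|M| <= mu S)%N.
Proof. exact: (@leq_bigmax_cond _ _ (fun M : {set {set G}} => #|M|)). Qed.

Lemma matching_number_attained S : exists2 M, matching_in S M & #|M| = mu S.
Proof.
have : (0 < #|matching_in S|)%N.
  by apply/card_gt0P; exists set0; exact: matching_in0.
by move/(eq_bigmax_cond (fun M : {set {set G}} => #|M|)) => [M inM eqM]; exists M.
Qed.

Lemma matching_number_le S n :
  (forall M, matching_in S M -> (#|M| <= n)%N) -> (mu S <= n)%N.
Proof. by move=> le_n; apply/bigmax_leqP => M; apply: le_n. Qed.

Lemma matching_number_mono S S' : S \subset S' -> (mu S <= mu S')%N.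
Proof.
move=> sSS'; apply: matching_number_le => M /andP[mM cM].
by apply: leq_matching_number; rewrite /matching_in mM (subset_trans cM).
Qed.

Lemma matching_number_isolated S v :
  (forall q, q \in S -> ~~ edge v q) -> mu S = mu (S :\ v).
Proof.
move=> iso_v; apply/eqP; rewrite eqn_leq (matching_number_mono (subD1set S v)) andbT.
apply: matching_number_le => M /andP[mM cM]; apply: leq_matching_number.
rewrite /matching_in mM subsetD1 cM /=; apply/bigcupP => -[A AM vA].
have /andP[/subsetP/(_ A AM) AE _] := mM.
have [q vq eqA] := edges_at AE vA.
have /iso_v : q \in S.
  by rewrite (subsetP cM) //; apply/bigcupP; exists A; rewrite // eqA set22.
by rewrite vq.
Qed.

(** Some maximum matching uses the edge from a leaf [u] to its neighbour [p]. *)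
Lemma matching_number_leaf S u p : u \in S -> p \in S -> edge u p ->
  (forall q, q \in S -> edge u q -> q = p) -> mu S = (mu (S :\ u :\ p)).+1.
Proof.
move=> uS pS up leaf_u; apply/eqP; rewrite eqn_leq; apply/andP; split.
  apply: matching_number_le => M /andP[/andP[ME tM] cM].
  pose M1 := [set A in M | p \in A]; pose M2 := [set A in M | p \notin A].
  have -> : #|M| = (#|M1| + #|M2|)%N.
    rewrite -(cardsID [set A : {set G} | p \in A] M); congr (_ + _)%N.
      by apply: eq_card => A; rewrite !inE.
    by apply: eq_card => A; rewrite !inE andbC.
  rewrite -add1n leq_add //.
    apply/card_le1_eqP => A B; rewrite !inE => /andP[AM pA] /andP[BM pB].
    apply/eqP; apply: contraTT isT => neqAB.
    have /disjoint_setI0/setP/(_ p) := trivIsetP tM B A BM AM neqAB.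
    by rewrite !inE pA pB.
  apply: leq_matching_number; rewrite /matching_in /matching.
  have sM : M2 \subset M by apply/subsetP => A; rewrite inE => /andP[].
  rewrite (subset_trans sM ME) (trivIsetS sM tM) /=.
  apply/subsetP => x /bigcupP[A]; rewrite inE => /andP[AM pA] xA.
  have AS : A \subset S by apply: subset_trans cM; apply: bigcup_sup AM.
  rewrite !inE (subsetP AS) // andbT; apply/andP; split.
    by apply: contraNneq pA => <-.
  apply: contraNneq pA => eqxu; rewrite eqxu in xA.
  have [q uq eqA] := edges_at (subsetP ME _ AM) xA.
  have qA : q \in A by rewrite eqA set22.
  by rewrite -(leaf_u q) // (subsetP AS).
have [M /andP[/andP[ME tM] cM] <-] := matching_number_attained (S :\ u :\ p).
have uM : u \notin cover M.
  by apply: contraTN isT => /(subsetP cM); rewrite !inE eqxx andbF.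
have pM : p \notin cover M.
  by apply: contraTN isT => /(subsetP cM); rewrite !inE eqxx.
have upM : [set u; p] \notin M.
  by apply: contra uM => upM; apply/bigcupP; exists [set u; p]; rewrite // set21.
rewrite -(addn1 #|M|) addnC -[(1 + _)%N]/(true + #|M|)%N -upM -cardsU1.
apply: leq_matching_number; rewrite /matching_in /matching.
rewrite subUset sub1set mem_edges up ME /=; apply/andP; split.
  apply: trivIsetU (trivIset1 _) tM _; rewrite cover1 disjoints_subset.
  by apply/subsetP => x /set2P[]->; rewrite inE.
apply/bigcupsP => A /setU1P[->|AM].
  by apply/subsetP => x /set2P[->|->].
apply: subset_trans (bigcup_sup _ AM) _; apply: subset_trans cM _.
by rewrite (subset_trans (subD1set _ _)) ?subD1set.
Qed.

(** * Forests *)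

(** If [v] is not isolated in [S], then a path in [S] that starts at [v] and
    cannot be prolonged ends at a leaf other than [v]. The path is kept in
    reverse order, as [:: u, p & s] with last vertex [v]. *)
Lemma exists_leaf S v : (forall d : seq G, ~~ is_cycle d) -> v \in S ->
  (exists2 q, q \in S & edge v q) ->
  exists u, exists p, [/\ u \in S, p \in S, u != v, edge u p &
    forall q, q \in S -> edge u q -> q = p].
Proof.
move=> acyclic vS [q qS vq].
pose leaf u p := [&& u \in S, p \in S, u != v, edge u p &
  [forall q in S, edge u q ==> (q == p)]].
suff /existsP[u /existsP[p /and5P[uS pS uv up /forall_inP leaf_u]]] :
    [exists u, exists p, leaf u p].
  exists u, p; split=> // q' q'S uq'; apply/eqP.
  by have /implyP := leaf_u q' q'S; apply.
apply: contraT; rewrite negb_exists => /forallP no_leaf.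
suff long n : exists u, exists p, exists s, [/\ uniq [:: u, p & s],
    path (@edge R G) u (p :: s), {subset [:: u, p & s] <= S},
    last p s = v & size s = n].
  have [u [p [s [uniq_s _ _ _ size_s]]]] := long #|G|.
  by have := uniq_leq_size uniq_s (fun x _ => mem_enum G x);
    rewrite -cardE /= size_s leqNgt ltnS leqnSn.
elim: n => [|n [u [p [s [uniq_s path_s sub_s last_s size_s]]]]].
  exists q, v, [::]; split=> //=; last first.
  - by move=> x; rewrite !inE => /pred2P[] ->.
  - by rewrite edge_sym vq.
  - by rewrite inE andbT; apply: contraTneq vq => ->; rewrite edge_irr.
have uv : u != v.
  have /andP[us _] := uniq_s; apply: contraNneq us => ->.
  by rewrite -last_s mem_last.
have uS : u \in S by rewrite sub_s // mem_head.
have pS : p \in S by rewrite sub_s // !inE eqxx orbT.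
have /andP[up _] := path_s.
have := no_leaf u; rewrite negb_exists => /forallP/(_ p).
rewrite /leaf uS pS uv up /= negb_forall_in => /exists_inP[q' q'S].
rewrite negb_imply => /andP[uq' neq_q'p].
have q'us : q' \notin [:: u, p & s].
  rewrite !inE (negPf neq_q'p) /= negb_or; apply/andP; split.
    by apply: contraTneq uq' => ->; rewrite edge_irr.
  (* Otherwise the edge from [u] to [q'] closes a cycle. *)
  apply/negP => /splitPr q's; case: q's uniq_s path_s {sub_s last_s size_s}.
  move=> s1 s2 uniq_s path_s; have /negP[] := acyclic (u :: p :: rcons s1 q').
  apply/and3P; split; first by rewrite /= size_rcons.
    move: uniq_s; rewrite -cat_rcons -[u :: p :: _]/([:: u, p & _] ++ s2).
    by rewrite cat_uniq => /and3P[].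
  move: path_s; rewrite -cat_rcons -cat_cons cat_path => /andP[+ _].
  rewrite /path.cycle rcons_path => -> /=.
  by rewrite last_rcons edge_sym.
exists q', u, (p :: s); split=> //=.
- by rewrite q'us.
- by rewrite edge_sym uq'.
- by move=> x; rewrite inE => /predU1P[->|/sub_s].
- by rewrite size_s.
Qed.

(** The alternative between a kernel vector with value 1 at [v] and a preimage
    of [e_v] with value 0 at [v], for the forest induced by [S]. Here [b] says
    that some maximum matching of that forest misses [v]. *)
Lemma forest_vector S v : (forall d : seq G, ~~ is_cycle d) -> v \in S ->
  let b := mu S == mu (S :\ v) in
  exists f : G -> R, [/\ forall s, s \notin S -> f s = 0, f v = b%:R &
    forall t, t \in S -> \sum_s f s * adj s t = (~~ b && (t == v))%:R].
Proof.
move=> acyclic; have [n] := ubnP #|S|; elim: n S v => // n IHn S v ltSn vS b.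
have sum_delta (x : G) (k : R) t :
    \sum_s (if s == x then k else 0) * adj s t = k * adj x t.
  rewrite (bigD1 x) //= eqxx big1 ?addr0 // => s /negPf->.
  by rewrite mul0r.
have [/exists_inP nbr_v|iso_v] := boolP [exists q in S, edge v q]; last first.
  have {}iso_v q : q \in S -> ~~ edge v q.
    by move=> qS; move: iso_v; rewrite negb_exists_in => /forall_inP; apply.
  have bT : b by rewrite /b (matching_number_isolated iso_v).
  exists (fun s => if s == v then 1 else 0); split=> [s sS||t tS].
  - by case: eqP sS => // ->; rewrite vS.
  - by rewrite eqxx bT.
  - by rewrite sum_delta /adj (negPf (iso_v t tS)) mulr0 bT.
have [u [p [uS pS uv up leaf_u]]] := exists_leaf acyclic vS nbr_v.
have adj_up : adj u p != 0 by rewrite /adj up gt_eqF ?weight_gt0.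
have adj_u t : t \in S -> t != p -> adj u t = 0.
  move=> tS tp; rewrite /adj; case: ifP => // /(leaf_u t tS) eqt.
  by rewrite eqt eqxx in tp.
have up_neq : u != p by apply: contraTneq up => ->; rewrite edge_irr.
have eq_muS := matching_number_leaf uS pS up leaf_u.
have [eqvp|vp] := eqVneq v p.
  have bF : b = false.
    rewrite /b eq_muS eqvp setDDl setUC -setDDl -(@matching_number_isolated _ u).
      by rewrite gtn_eqF.
    move=> q; rewrite !inE => /andP[qp qS]; apply: contra qp.
    by move/(leaf_u q qS)->.
  exists (fun s => if s == u then (adj u p)^-1 else 0); split=> [s sS||t tS].
  - by case: eqP sS => // ->; rewrite uS.
  - by rewrite eq_sym (negPf uv) bF.
  - rewrite sum_delta bF /= eqvp; have [->|tp] := eqVneq t p.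
      by rewrite mulVf.
    by rewrite (adj_u t) // mulr0.
pose S' := S :\ u :\ p.
have vS' : v \in S' by rewrite !inE vp eq_sym uv.
have ltS'n : (#|S'| < n)%N.
  rewrite -ltnS (leq_trans _ ltSn) // ltnS proper_card // properE.
  rewrite (subset_trans (subD1set _ _)) ?subD1set //=.
  by apply/subsetPn; exists u; rewrite // !inE eqxx andbF.
have [f [f0 fv f_eq]] := IHn S' v ltS'n vS'.
have eqb : (mu S' == mu (S' :\ v)) = b.
  rewrite /b eq_muS (@matching_number_leaf (S :\ v) u p).
  - have -> : S' :\ v = S :\ v :\ u :\ p.
      by apply/setP => x; rewrite !inE; case: (x == v); rewrite ?andbF.
    by [].
  - by rewrite !inE uv.
  - by rewrite !inE eq_sym vp.
  - by [].
  - by move=> q; rewrite inE => /andP[_]; apply: leaf_u.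
rewrite eqb in fv f_eq.
have fp : f p = 0 by rewrite f0 // !inE eqxx.
have fu : f u = 0 by rewrite f0 // !inE eqxx andbF.
(* The value at [u] that makes the row of [p] vanish. *)
pose k := - (\sum_s f s * adj s p) / adj u p.
exists (fun s => f s + if s == u then k else 0); split=> [s sS||t tS].
- rewrite f0 ?inE ?(negPf sS) ?andbF //; case: eqP sS => [->|_ _].
    by rewrite uS.
  by rewrite addr0.
- by rewrite eq_sym (negPf uv) addr0.
rewrite (eq_bigr (fun s => f s * adj s t + (if s == u then k else 0) * adj s t)).
  rewrite big_split /= sum_delta; have [->|tp] := eqVneq t p.
    by rewrite mulfVK // subrr eq_sym (negPf vp) andbF.
  rewrite (adj_u t) // mulr0 addr0; have [->|tu] := eqVneq t u; last first.
    by rewrite f_eq // !inE tp tu.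
  rewrite (negPf uv) andbF big1 // => s _.
  have [->|sp] := eqVneq s p; first by rewrite fp mul0r.
  have [sS|sS] := boolP (s \in S); first by rewrite adj_sym adj_u ?mulr0.
  by rewrite f0 ?mul0r // !inE (negPf sS) !andbF.
by move=> s _; rewrite mulrDl.
Qed.

End Matching.

Lemma mismatched_matching_number (R : rcfType) (G : wgraph R) (v : G) :
  mismatched v = (matching_number [set: G] == matching_number ([set: G] :\ v)).
Proof.
have in_setT M : @matching_in R G setT M = matching M.
  by rewrite /matching_in subsetT andbT.
rewrite /mismatched; have [G1|_] /= := eqVneq #|G| 1%N.
  rewrite (@matching_number_isolated _ _ _ v) ?eqxx // => q _.
  have /card_le1_eqP/(_ v q) := eq_leq G1.
  by move=> ->; rewrite ?inE // edge_irr.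
apply/existsP/eqP => [[M /andP[/andP[mM /forallP maxM] vM]]|eq_mu].
  apply/eqP; rewrite eqn_leq (matching_number_mono (subD1set _ _)) andbT.
  apply: (@leq_trans #|M|).
    apply: matching_number_le => N; rewrite in_setT => mN.
    by have /implyP := maxM N; apply.
  by apply: leq_matching_number; rewrite /matching_in mM subsetD1 subsetT.
have [M /andP[mM]] := matching_number_attained ([set: G] :\ v).
rewrite subsetD1 => /andP[_ vM] eqM; exists M; rewrite vM andbT /maximum_matching mM.
apply/forallP => N; apply/implyP => mN.
by rewrite eqM -eq_mu leq_matching_number // in_setT.
Qed.

(** * Connectivity and the number of edges *)

Section EdgeSets.
Variable V : finType.
Implicit Types (F : {set {set V}}) (a b x y : V) (s : seq V).

(** Adjacency in the graph on [V] whose edge set is [F]. *)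
Definition erel F : rel V := fun x y => [set x; y] \in F.

Lemma erel_csym F : connect_sym (erel F).
Proof. by apply: sym_connect_sym => x y; rewrite /erel setUC. Qed.

Lemma connect_erelS F F' : F \subset F' ->
  subrel (connect (erel F)) (connect (erel F')).
Proof.
by move=> sFF'; apply: connect_sub => x y xy; apply/connect1/(subsetP sFF').
Qed.

Lemma connect_del_edge F a b : connect (erel (F :\ [set a; b])) a b ->
  subrel (connect (erel F)) (connect (erel (F :\ [set a; b]))).
Proof.
move=> ab; apply: connect_sub => x y xy.
have [eqxy|neqxy] := eqVneq [set x; y] [set a; b]; last first.
  by apply: connect1; rewrite /erel in_setD1 neqxy.
have : x \in [set a; b] by rewrite -eqxy set21.
have : y \in [set a; b] by rewrite -eqxy set22.
case/set2P=> ->; case/set2P=> -> //.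
by rewrite erel_csym.
Qed.

(** A connected graph on [n] vertices has at least [n - 1] edges: a vertex set
    grown one vertex at a time along [F] gains a new edge at each step. *)
Lemma connected_leq_card_edges F :
  (forall x y, connect (erel F) x y) -> (#|V| <= #|F|.+1)%N.
Proof.
move=> conn; case cardV: #|V| => [|n] //; rewrite ltnS.
have [x0 _] : exists x0 : V, x0 \in predT by apply/card_gt0P; rewrite cardV.
suff: exists2 S : {set V}, #|S| = n.+1 & (n <= #|[set A in F | A \subset S]|)%N.
  case=> S _ /leq_trans; apply; apply/subset_leq_card/subsetP => A.
  by rewrite inE => /andP[].
have := leqnn n; move: {1 3 4}n => k; elim: k => [_|k IHk ltkn].
  by exists [set x0]; rewrite ?cards1.
have [S cardS leS] := IHk (ltnW ltkn).
have [a aS] : exists a, a \in S by apply/card_gt0P; rewrite cardS.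
have [b bS] : exists b, b \notin S.
  apply/existsP; rewrite -negb_forall; apply: contraTN ltkn => /forallP allS.
  have : (#|V| <= #|S|)%N by apply/subset_leq_card/subsetP => x _; apply: allS.
  by rewrite cardV cardS -leqNgt !ltnS.
have /exists_inP[x xS /exists_inP[y yS xy]] :
    [exists x in S, [exists y in ~: S, erel F x y]].
  apply: contraT => no_xy; suff closedS : closed (erel F) (mem S).
    by have /= := closed_connect closedS (conn a b); rewrite /= aS (negPf bS).
  have stepS x y : erel F x y -> x \in S -> y \in S.
    move=> xy xS; apply: contraR no_xy => yS.
    by apply/exists_inP; exists x => //; apply/exists_inP; exists y; rewrite ?inE.
  move=> x y xy; apply/idP/idP; first exact: stepS.
  by apply: stepS; rewrite /erel setUC.
rewrite inE in yS; exists (y |: S); first by rewrite cardsU1 yS cardS.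
set E1 := [set A in F | A \subset S] in leS; set E2 := [set A in F | _].
have xyE1 : [set x; y] \notin E1.
  by rewrite inE subUset !sub1set (negPf yS) !andbF.
apply: (@leq_trans #|[set x; y] |: E1|); first by rewrite cardsU1 xyE1 ltnS.
apply/subset_leq_card/subsetP => A /setU1P[->|].
  by rewrite inE subUset !sub1set !inE xS eqxx orbT andbT.
by rewrite !inE => /andP[-> AS]; rewrite (subset_trans AS) ?subsetUr.
Qed.

Lemma path_del_closing_edge F x s : uniq (x :: s) -> (1 < size s)%N ->
  path (erel F) x s -> path (erel (F :\ [set x; last x s])) x s.
Proof.
move=> uniq_s lt1s /(pathP x) path_s; apply/(pathP x) => i lt_is.
rewrite /erel in_setD1 [_ \in F]path_s // andbT.
have nthK j k : (j <= size s)%N -> (k <= size s)%N ->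
    (nth x (x :: s) j == nth x (x :: s) k) = (j == k).
  by move=> lej lek; rewrite nth_uniq.
apply/eqP => eq_set; have eq_last : last x s = nth x (x :: s) (size s).
  by rewrite nth_last.
have : nth x (x :: s) 0 \in [set nth x (x :: s) i; nth x s i].
  by rewrite eq_set set21.
have : last x s \in [set nth x (x :: s) i; nth x s i] by rewrite eq_set set22.
rewrite eq_last -[nth x s i]/(nth x (x :: s) i.+1) !in_set2 !nthK // 1?ltnW //.
case: i lt_is {path_s eq_set} => [|i] //= _.
by case: (size s) lt1s => [|[|]].
Qed.

End EdgeSets.

(** * The cycle of a unicyclic graph *)

Section Cycles.
Variables (R : rcfType) (G : wgraph R).
Implicit Types (c d : seq G) (x y a b v : G) (S T : {set G}) (F : {set {set G}}).

Lemma edge_erel : @edge R G =2 erel (edges G).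
Proof. by move=> x y; rewrite /erel mem_edges. Qed.

(** The edges of the cycle [c], as a set of vertex pairs. *)
Definition cycle_edges c := [set [set x; next c x] | x in c].

Lemma edge_next_cycle c x : is_cycle c -> x \in c -> edge x (next c x).
Proof. by case/and3P=> _ _ cyc; apply: next_cycle cyc. Qed.

Lemma cycle_edges_sub c : is_cycle c -> cycle_edges c \subset edges G.
Proof.
move=> cycC; apply/subsetP => _ /imsetP[x xc ->].
by rewrite mem_edges edge_next_cycle.
Qed.

Lemma cycle_edge_sub c A : A \in cycle_edges c -> {subset A <= c}.
Proof. by case/imsetP=> x xc -> y /set2P[->|->]; rewrite ?mem_next. Qed.

Lemma cycle_broken_connect c : is_cycle c ->
  exists2 f, f \in cycle_edges c &
    {in c &, forall x y, connect (erel (cycle_edges c :\ f)) x y}.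
Proof.
case/and3P=> lt2c uniq_c _.
have cyc : path.cycle (erel (cycle_edges c)) c.
  by apply: cycle_from_next => // x xc; apply/imsetP; exists x.
set F := cycle_edges c in cyc *.
case: c @F lt2c uniq_c cyc => // x s F lt1s uniq_s.
rewrite /path.cycle rcons_path => /andP[path_s last_s].
exists [set x; last x s]; first by rewrite setUC.
have /path_connect conn := path_del_closing_edge uniq_s lt1s path_s.
move=> y z ys zs; apply: (@connect_trans _ _ x); last exact: conn.
by rewrite erel_csym; apply: conn.
Qed.

(** For a suitable edge [e] of the cycle, each edge other than [e] is a bridge
    of [G] minus [e]. *)
Lemma unicyclic_bridge c : unicyclic G -> is_cycle c ->
  exists e, [/\ e \in cycle_edges c,
    {in c &, forall x y, connect (erel (cycle_edges c :\ e)) x y} &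
    forall F a b, F \subset edges G -> e \notin F ->
      edge a b -> [set a; b] != e -> [set a; b] \notin F ->
      ~~ connect (erel F) a b].
Proof.
case/andP=> /andP[_ /forallP conn] /eqP cardE cyc.
have [e ec conn_c] := cycle_broken_connect cyc.
have sub_cE := cycle_edges_sub cyc; have eE := subsetP sub_cE e ec.
exists e; split=> // F a b FE eF ab neq_abe abF; apply/negP => conn_ab.
have connE x y : connect (erel (edges G)) x y.
  by rewrite -(eq_connect edge_erel); have /forallP := conn x; apply.
have connE1 x y : connect (erel (edges G :\ e)) x y.
  have /imsetP[z zc eq_e] := ec; have := connE x y.
  rewrite eq_e; apply: connect_del_edge; rewrite -eq_e.
  apply: (connect_erelS (setSD _ sub_cE)); apply: conn_c => //.
  by rewrite mem_next.
have connE2 x y : connect (erel (edges G :\ e :\ [set a; b])) x y.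
  apply: connect_del_edge (connE1 x y); apply: connect_erelS conn_ab.
  by rewrite !subsetD1 FE eF.
have := connected_leq_card_edges connE2.
rewrite -cardE (cardsD1 e) eE (cardsD1 [set a; b] (_ :\ e)).
by rewrite in_setD1 neq_abe mem_edges ab ltnn.
Qed.

Lemma unicyclic_chordless c x y : unicyclic G -> is_cycle c ->
  x \in c -> y \in c -> edge x y -> [set x; y] \in cycle_edges c.
Proof.
move=> unicG cyc xc yc xy; have [e [ec conn_c bridge]] := unicyclic_bridge unicG cyc.
apply: contraT => xyc; have := conn_c x y xc yc; apply/contraLR => _.
apply: bridge => //.
- exact: subset_trans (subD1set _ _) (cycle_edges_sub cyc).
- by rewrite setD11.
- by apply: contraNneq xyc => ->.
- by apply: contra xyc => /setD1P[].
Qed.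

(** The edges of [G] with both ends in [S]. *)
Definition edges_in S := [set A in edges G | A \subset S].

Lemma edges_in_sub S : edges_in S \subset edges G.
Proof. by apply/subsetP => A; rewrite inE => /andP[]. Qed.

Lemma edges_inS S T : S \subset T -> edges_in S \subset edges_in T.
Proof.
move=> sST; apply/subsetP => A; rewrite !inE => /andP[-> AS].
exact: subset_trans AS sST.
Qed.

Lemma mem_edges_in S x y :
  ([set x; y] \in edges_in S) = [&& edge x y, x \in S & y \in S].
Proof. by rewrite inE mem_edges subUset !sub1set. Qed.

Lemma connected_inducedP S : reflect
  ((exists x, x \in S) /\ {in S &, forall x y, connect (erel (edges_in S)) x y})
  (connected (induced S)).
Proof.
apply: (iffP andP) => [[/card_gt0P[x _] conn]|[[x xS] conn]].
  split.
    by exists (sval (x : {x | x \in S})); exact: (svalP (x : {x | x \in S})).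
  move=> a b aS bS.
  pose a' : induced S := exist _ a aS; pose b' : induced S := exist _ b bS.
  have /connectP[s path_s eq_b] : connect (@edge R (induced S)) a' b'.
    by have /forallP/(_ a')/forallP/(_ b') := conn.
  apply/connectP; exists [seq sval (z : {x | x \in S}) | z <- s].
    apply: (homo_path _ path_s : path _ (sval (a' : {x | x \in S})) _).
    move=> [y yS] [z zS] /andP[yz _]; rewrite /erel mem_edges_in /=.
    by apply/and3P; split.
  by rewrite -[a]/(sval (a' : {x | x \in S})) last_map -eq_b.
split; first by apply/card_gt0P; exists (exist _ x xS).
apply/forallP => a; apply/forallP => b.
have /connectP[s path_s eq_b] := conn _ _
  (svalP (a : {x | x \in S})) (svalP (b : {x | x \in S})).
elim: s a path_s eq_b {x xS conn} => [|z s IHs] a /=.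
  by move=> _ /val_inj ->.
rewrite {1}/erel mem_edges_in => /andP[/and3P[az _ zS] path_s] eq_b.
pose z' : induced S := exist _ z zS.
apply: (@connect_trans _ _ z'); last exact: IHs.
by apply: connect1; apply/andP; rewrite in_setT.
Qed.

(** * The trees attached to the cycle *)

Section Branch.
Variables (c : seq G) (v : G).
Hypotheses (unicG : unicyclic G) (cycC : is_cycle c) (vc : v \in c).
Local Notation T := (branch_set c v).

Lemma branch_setP : [/\ v \in T, {in c, forall x, x \in T -> x = v},
  {in T &, forall x y, connect (erel (edges_in T)) x y} &
  forall S, branch_set_cond c v S -> (#|S| <= #|T|)%N].
Proof.
rewrite /branch_set; case: arg_maxnP; first exact: branch_set_cond1.
move=> S /and3P[vS /forall_inP Sc /connected_inducedP[_ conn]] maxS.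
by split=> // x xc xS; apply/eqP; have /implyP := Sc x xc; apply.
Qed.

(** Maximality of the branch: its outer neighbours all lie on the cycle. *)
Lemma branch_edge_out x y :
  x \in T -> y \notin T -> y \notin c -> ~~ edge x y.
Proof.
have [vT Tc conn maxT] := branch_setP => xT yT yc; apply/negP => xy.
suff /maxT : branch_set_cond c v (y |: T) by rewrite cardsU1 yT ltnn.
apply/and3P; split; first by rewrite !inE vT orbT.
  apply/forall_inP => z zc; apply/implyP => /setU1P[eqzy|zT].
    by rewrite -eqzy zc in yc.
  by rewrite (Tc z).
apply/connected_inducedP; split; first by exists v; rewrite !inE vT orbT.
suff conn_x z : z \in y |: T -> connect (erel (edges_in (y |: T))) x z.
  move=> a b aT bT; apply: (@connect_trans _ _ x); last exact: conn_x.
  by rewrite erel_csym conn_x.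
case/setU1P=> [->|zT].
  by apply: connect1; rewrite /erel mem_edges_in xy !inE xT eqxx orbT.
by apply: connect_erelS (conn _ _ xT zT); apply/edges_inS/subsetUr.
Qed.

(** The root [v] is the only vertex of the branch that can have neighbours outside. An
    edge from another vertex [x] to [y] on the cycle would be bypassed by going
    from [x] to [v] inside the branch and from [v] to [y] along the cycle. *)
Lemma branch_edge_root x y :
  x \in T -> x != v -> y \notin T -> ~~ edge x y.
Proof.
have [vT Tc conn _] := branch_setP => xT neq_xv yT.
have [yc|] := boolP (y \in c); last exact: branch_edge_out.
apply/negP => xy; have [e [ec conn_c bridge]] := unicyclic_bridge unicG cycC.
have xc : x \notin c by apply: contra neq_xv => /Tc->.
have sub_ec := cycle_edge_sub ec.
have /imsetP[z zc eq_e] := ec.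
have z_edge := edge_next_cycle cycC zc.
have e_out : e \notin edges_in T.
  rewrite eq_e mem_edges_in z_edge /=; apply/andP => -[zT nzT].
  by move: z_edge; rewrite (Tc (next c z)) ?mem_next // (Tc z) // edge_irr.
have xy_c A : A \in cycle_edges c -> [set x; y] != A.
  move=> /cycle_edge_sub subA; apply: contraNneq xc => eqA.
  by rewrite subA // -eqA set21.
set F := edges_in T :|: cycle_edges c :\ e.
have conn_xy : connect (erel F) x y.
  apply: (@connect_trans _ _ v).
    by apply: connect_erelS (conn _ _ xT vT); apply: subsetUl.
  by apply: connect_erelS (conn_c _ _ vc yc); apply: subsetUr.
suff : ~~ connect (erel F) x y by rewrite conn_xy.
apply: bridge; rewrite ?xy_c //.
- rewrite subUset edges_in_sub.
  exact: subset_trans (subD1set _ _) (cycle_edges_sub cycC).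
- by rewrite in_setU setD11 orbF.
- rewrite in_setU mem_edges_in (negPf yT) !andbF /= in_setD1 negb_and.
  by apply/orP; right; apply: contraT => /negbNE/xy_c; rewrite eqxx.
Qed.

Lemma branch_acyclic (d : seq (branch c v)) : ~~ is_cycle d.
Proof.
have [vT Tc conn _] := branch_setP; apply/negP => cycd.
pose h (w : branch c v) : G := sval (w : {x | x \in T}).
have hT w : h w \in T := svalP (w : {x | x \in T}).
have cyc_hd : is_cycle (map h d).
  case/and3P: cycd => size_d uniq_d cyc_d; apply/and3P; split.
  - by rewrite size_map.
  - by rewrite map_inj_uniq //; apply: val_inj.
  - by apply: homo_cycle cyc_d => w w' /andP[].
have sub_dT x : x \in map h d -> x \in T by case/mapP=> w _ ->.
have [e [ec _ bridge]] := unicyclic_bridge unicG cycC.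
have e_out : e \notin cycle_edges (map h d).
  apply/negP => /cycle_edge_sub sub_ed; have /imsetP[z zc eq_e] := ec.
  have zT : z \in T by rewrite sub_dT // sub_ed // eq_e set21.
  have nzT : next c z \in T by rewrite sub_dT // sub_ed // eq_e set22.
  have := edge_next_cycle cycC zc.
  by rewrite (Tc (next c z)) ?mem_next // (Tc z) // edge_irr.
have [f fd conn_d] := cycle_broken_connect cyc_hd.
have /imsetP[a ad eq_f] := fd; set b := next _ a in eq_f.
set F := cycle_edges (map h d) :\ f in conn_d.
suff : ~~ connect (erel F) a b by rewrite conn_d ?mem_next.
apply: bridge.
- exact: subset_trans (subD1set _ _) (cycle_edges_sub cyc_hd).
- by rewrite in_setD1 (negPf e_out) andbF.
- exact: edge_next_cycle.
- by rewrite -eq_f; apply: contraNneq e_out => <-.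
- by rewrite -eq_f setD11.
Qed.

End Branch.

End Cycles.

(** A vector on the vertices of an induced subgraph, extended by 0 to [G]. *)
Lemma induced_vector (R : rcfType) (G : wgraph R) (S : {set G})
    (f : induced S -> R) : exists2 z : G -> R,
  forall x (xS : x \in S), z x = f (exist _ x xS) &
  forall x (xS : x \in S), \sum_(s in S) z s * adj s x
    = \sum_(s : induced S) f s * adj s (exist _ x xS : induced S).
Proof.
pose z x := if insub x is Some h then f (h : {x | x \in S}) else 0.
have zE x (xS : x \in S) : z x = f (exist _ x xS).
  by rewrite /z insubT.
exists z => // x xS.
rewrite [LHS]big_sub; apply: eq_bigr => -[s sS] _ /=.
by rewrite (zE s sS) /adj /= in_setT andbT.
Qed.

(** The alternative of [forest_vector] at the root of a branch, read in [G]. *)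
Lemma branch_vector (R : rcfType) (G : wgraph R) (c : seq G) (v : G) :
  unicyclic G -> is_cycle c -> v \in c ->
  let b := mismatched (branch_root c v) in
  exists2 z : G -> R, z v = b%:R &
    forall t, t \in branch_set c v ->
      \sum_(s in branch_set c v) z s * adj s t = (~~ b && (t == v))%:R.
Proof.
move=> unicG cycC vc b.
have [f [_ fv f_eq]] := forest_vector (@branch_acyclic _ _ c v unicG cycC)
  (in_setT (branch_root c v)).
rewrite -mismatched_matching_number in fv f_eq.
have [z zE z_sum] := induced_vector f.
exists z; first by rewrite (zE v (mem_branch_set c v)).
by move=> t tT; rewrite z_sum f_eq.
Qed.

(** * Inertia of unicyclic graphs *)

Lemma i_posE (R : rcfType) (G : wgraph R) : i_pos G = sign_count 1 (adjacency G).
Proof. by apply: eq_bigl => x; rewrite mul1r. Qed.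

Lemma i_negE (R : rcfType) (G : wgraph R) : i_neg G = sign_count (-1) (adjacency G).
Proof. by apply: eq_bigl => x; rewrite mulN1r oppr_gt0. Qed.

Lemma sign_count_typeI (R : rcfType) (G : wgraph R) (c : seq G) (v : G) (e : R) :
  unicyclic G -> is_cycle c -> v \in c -> matched (branch_root c v) ->
  sign_count e (adjacency G) = (sign_count e (adjacency (branch c v))
    + sign_count e (adjacency (delete (branch_set c v))))%N.
Proof.
move=> unicG cycC vc /negPf matched_v.
have [z zv z_sum] := branch_vector unicG cycC vc.
rewrite matched_v in zv z_sum; set T := branch_set c v in z_sum *.
have out x y : x \in T -> x != v -> y \notin T -> adj x y = 0.
  by move=> xT xv yT; rewrite /adj (negPf (branch_edge_root unicG cycC vc xT xv yT)).
apply: (@sign_count_split _ _ _ _ _ _ (fun j s => - adj j v * z s)) => //.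
  move=> j t jT tT; under eq_bigr => s _ do rewrite -mulrA.
  rewrite -mulr_sumr z_sum //=; have [->|tv] := eqVneq t v.
    by rewrite mulr1 subrr.
  by rewrite adj_sym out // mulr0 addr0.
move=> j k jT kT; rewrite in_setT big1 ?addr0 // => s sT.
have [->|sv] := eqVneq s v; first by rewrite zv mulr0 mul0r.
by rewrite (out s k) // mulr0.
Qed.

Lemma sign_count_typeII (R : rcfType) (G : wgraph R) (c : seq G) (e : R) :
  unicyclic G -> is_cycle c -> typeII c ->
  sign_count e (adjacency G) = (sign_count e (adjacency (delete [set x in c]))
    + sign_count e (adjacency (cycle_graph c)))%N.
Proof.
move=> unicG cycC no_matched.
have /fin_all_exists[z zP] : forall v, exists z : G -> R, v \in c ->
    z v = 1 /\ forall t, t \in branch_set c v ->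
      \sum_(s in branch_set c v) z s * adj s t = 0.
  move=> v; have [vc|_] := boolP (v \in c); last by exists (fun=> 0).
  have [z zv z_sum] := branch_vector unicG cycC vc.
  have mis : mismatched (branch_root c v).
    apply: contraR no_matched => matched_v; apply/existsP; exists v.
    by rewrite vc.
  by exists z => _; rewrite zv mis; split=> // t /z_sum->; rewrite mis.
pose N j s := if s \in branch_set c j then z j s else 0.
(* At [j] on the cycle, [N j] is the kernel vector minus the unit vector of [j],
   since the branch meets the cycle in [j] only. *)
have sumN j t : j \in c -> adj j t + \sum_(s in ~: [set x in c]) N j s * adj s t
    = \sum_(s in branch_set c j) z j s * adj s t.
  move=> jc; have [zj _] := zP j jc; have [jT Tc _ _] := branch_setP c j.
  rewrite [RHS](bigD1 j) //= zj mul1r; congr (_ + _).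
  rewrite big_mkcond [RHS]big_mkcond; apply: eq_bigr => s _.
  rewrite !inE /N; case: ifPn => sc; case: (boolP (s \in _)) => sT //=.
  - by rewrite (contraNneq _ sc) // => ->.
  - by rewrite mul0r.
  - by rewrite (Tc s) ?eqxx // -[s \in c]negbK.
apply: (@sign_count_split _ _ _ _ _ _ N); first by rewrite setCK.
  move=> j t; rewrite !inE negbK => jc tc; rewrite sumN //.
  have [_ zj_sum] := zP j jc.
  have [/zj_sum//|tT] := boolP (t \in branch_set c j).
  rewrite big1 // => s sT.
  by rewrite /adj (negPf (branch_edge_out sT tT tc)) mulr0.
move=> j k; rewrite !inE !negbK => jc kc; rewrite sumN // -/(cycle_edges c).
have [zj zj_sum] := zP j jc; have [jT Tc _ _] := branch_setP c j.
have [->|kj] := eqVneq k j; first by rewrite adjxx if_same zj_sum.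
have kT : k \notin branch_set c j by apply: contra kj => /Tc->.
rewrite (bigD1 j) //= zj mul1r big1 ?addr0 => [|s /andP[sT sj]]; last first.
  by rewrite /adj (negPf (branch_edge_root unicG cycC jc sT sj kT)) mulr0.
case: ifPn => // jkc; rewrite /adj; case: ifPn => // jk.
by rewrite unicyclic_chordless in jkc.
Qed.

Theorem theorem3p10 (R : realType) (G : wgraph R) (c : seq G)
    (unicG : unicyclic G) (cycC : is_cycle c) :
  (typeI c ->
   forall v : G, v \in c -> matched (branch_root c v) ->
     i_pos G = (i_pos (branch c v) + i_pos (delete (branch_set c v)))%N /\
     i_neg G = (i_neg (branch c v) + i_neg (delete (branch_set c v)))%N) /\
  (typeII c ->
     i_pos G = (i_pos (delete [set x in c]) + i_pos (cycle_graph c))%N /\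
     i_neg G = (i_neg (delete [set x in c]) + i_neg (cycle_graph c))%N).
Proof.
split=> [_ v vc matched_v|no_matched]; rewrite !i_posE !i_negE.
  by split; apply: sign_count_typeI.
by split; apply: sign_count_typeII.
Qed.
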